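(* Let $d,N\in\mathbb{N}$ with $d\le N\le 2d-2$. Let $\{u_k\}_{k=1}^N$ and $\{v_k\}_{k=1}^N$ be unit vectors in $\mathbb{C}^d$ with weights $\{p_k\}_{k=1}^N\subseteq(0,\infty)$ satisfying: (1) $\sum_{k=1}^N p_k|u_k\rangle\langle u_k|=\sum_{k=1}^N p_k|v_k\rangle\langle v_k|=I_d$; (2) any $d$ vectors in $\{u_k\}_{k=1}^N$ are linearly independent, and any $d$ vectors in $\{v_k\}_{k=1}^N$ are linearly independent; (3) the set $\{|u_k\rangle\langle u_k|\oplus|v_k\rangle\langle v_k|\}_{k=1}^N\subseteq\mathbb{M}_d\oplus\mathbb{M}_d$ is linearly independent. Then the channel $\tau=\sum_{k=1}^N p_k\,\mathrm{Ad}_{|u_k\rangle\langle v_k|}$ is an extreme point of $\mathrm{UEBTP}(d)$ with Choi rank and EB rank equal to $N$. In particular, twisted dephasing channels are extreme points of $\mathrm{UEBTP}(d)$.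
   Context: $\mathbb{M}_d$ is the algebra of $d\times d$ complex matrices; $\mathrm{Ad}_V(X)=VXV^*$; $|x\rangle\langle y|$ is the rank-one operator $z\mapsto\langle y,z\rangle x$. A quantum channel on $\mathbb{M}_d$ is a completely positive (CP), trace-preserving linear map. A linear map $\varphi$ on $\mathbb{M}_d$ is entanglement breaking (EB) if for every $k\ge 1$ and every positive semidefinite $Z\in\mathbb{M}_d\otimes\mathbb{M}_k$, the matrix $(\varphi\otimes\mathrm{id}_k)(Z)$ is separable, i.e. a finite sum of $X_j\otimes Y_j$ with $X_j,Y_j$ positive semidefinite; equivalently, $\varphi=\sum_j\mathrm{Ad}_{V_j}$ (finite sum) with rank-one matrices $V_j$. $\mathrm{UEBTP}(d)$ is the compact convex set of all unital EB quantum channels on $\mathbb{M}_d$. The Choi rank of a CP map is the minimal number of matrices $V_j$ in a representation $\varphi=\sum_j\mathrm{Ad}_{V_j}$; the EB rank of an EB map is the minimal number of terms in such a representation with all $V_j$ of rank one. For unitaries $U,V\in\mathbb{M}_d$, the twisted dephasing channel is $\beta_{U,V}=\mathrm{Ad}_U\circ\Delta_d\circ\mathrm{Ad}_{V^*}$, where $\Delta_d(X)=\sum_{j=1}^d\langle e_j,Xe_j\rangle|e_j\rangle\langle e_j|$ and $\{e_j\}$ is the standard basis of $\mathbb{C}^d$. *)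

(* Defs.v *)
From HB Require Import structures.
From mathcomp Require Import all_boot all_order all_algebra.
From mathcomp Require Export mxtens complex.
From mathcomp Require Import boolp classical_sets functions reals.

Set Implicit Arguments.
Unset Strict Implicit.
Unset Printing Implicit Defensive.

Import Order.TTheory GRing.Theory Num.Theory.
Local Open Scope ring_scope.
Local Open Scope classical_set_scope.
Local Open Scope sesquilinear_scope.

(* The scalars t range over K itself.  When K is the field of complex numbers,
   0 < t < 1 forces t to be real, so this is extremality over the reals. *)
Definition extreme_point (K : numDomainType) (E : lmodType K) (A : set E)
    (x : E) : Prop :=
  A x /\ forall (y z : E) (t : K), A y -> A z -> 0 < t < 1 ->
    x = t *: y + (1 - t) *: z -> y = x /\ z = x.

Section MatrixMaps.
Variable C : numClosedFieldType.

(* <x, y>, conjugate-linear in x *)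
Definition inner d (x y : 'cV[C]_d) : C := (x^t* *m y) 0 0.

(* |x><y| *)
Definition ketbra d (x y : 'cV[C]_d) : 'M[C]_d := x *m y^t*.

Lemma ketbraE d (x y z : 'cV[C]_d) : ketbra x y *m z = inner y z *: x.
Proof.
by rewrite /ketbra /inner -mulmxA {1}[y^t* *m z]mx11_scalar mul_mx_scalar.
Qed.

(* A >= 0 in C includes A real, so psd matrices are Hermitian. *)
Definition psd n (A : 'M[C]_n) : Prop := forall x, 0 <= inner x (A *m x).

Definition Ad d (V X : 'M[C]_d) : 'M[C]_d := V *m X *m V^t*.

(* The (a, b) entry of Z, viewed as a k x k matrix over M_d:
   Z = \sum_(a, b) tens_block Z a b *t delta_mx a b. *)
Definition tens_block d k (Z : 'M[C]_(d * k)) (a b : 'I_k) : 'M[C]_d :=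
  \matrix_(i, j) Z (mxtens_index (i, a)) (mxtens_index (j, b)).

(* phi (x) id_k, for linear phi *)
Definition tens_id d k (phi : 'M[C]_d -> 'M[C]_d) (Z : 'M[C]_(d * k)) :
    'M[C]_(d * k) :=
  \sum_(a < k) \sum_(b < k) phi (tens_block Z a b) *t delta_mx a b.

Lemma tens_id_tensmx d k (phi : 'M[C]_d -> 'M[C]_d) (X : 'M[C]_d)
    (Y : 'M[C]_k) :
  linear phi -> tens_id phi (X *t Y) = phi X *t Y.
Proof.
move=> phiL; have phiZ c A : phi (c *: A) = c *: phi A.
  have := phiL (-1) 0 0; rewrite !scaleN1r !addNr => phi0.
  by rewrite -[c *: A]addr0 phiL phi0 addr0.
apply/matrixP=> r s.
case: (mxtens_indexP r) => i a; case: (mxtens_indexP s) => j b.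
rewrite tensmxE /tens_id summxE (bigD1 a) //= summxE (bigD1 b) //=.
have -> : tens_block (X *t Y) a b = Y a b *: X.
  by apply/matrixP=> i' j'; rewrite !mxE !mxtens_indexK mulrC.
rewrite phiZ tensmxE !mxE !eqxx mulr1 mulrC big1 ?addr0 => [|b' nb].
  rewrite big1 ?addr0 // => a' na; rewrite summxE big1 // => b' _.
  by rewrite tensmxE !mxE eq_sym (negPf na) mulr0.
by rewrite tensmxE !mxE [b == _]eq_sym (negPf nb) andbF mulr0.
Qed.

Definition completely_positive d (phi : 'M[C]_d -> 'M[C]_d) : Prop :=
  linear phi /\ forall k (Z : 'M[C]_(d * k)), (0 < k)%N ->
    psd Z -> psd (tens_id phi Z).

Definition quantum_channel d (phi : 'M[C]_d -> 'M[C]_d) : Prop :=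
  completely_positive phi /\ forall X, \tr (phi X) = \tr X.

Definition separable d k (Z : 'M[C]_(d * k)) : Prop :=
  exists m (X : 'I_m -> 'M[C]_d) (Y : 'I_m -> 'M[C]_k),
    [/\ forall j, psd (X j), forall j, psd (Y j)
      & Z = \sum_j X j *t Y j].

Definition entanglement_breaking d (phi : 'M[C]_d -> 'M[C]_d) : Prop :=
  linear phi /\ forall k (Z : 'M[C]_(d * k)), (0 < k)%N ->
    psd Z -> separable (tens_id phi Z).

Definition UEBTP d : set ('M[C]_d -> 'M[C]_d) :=
  [set phi | [/\ quantum_channel phi, phi 1%:M = 1%:M
               & entanglement_breaking phi]].

Definition choi_rank_is d (phi : 'M[C]_d -> 'M[C]_d) (r : nat) : Prop :=
  (exists V : 'I_r -> 'M[C]_d, phi = \sum_j Ad (V j)) /\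
  forall m (V : 'I_m -> 'M[C]_d), phi = \sum_j Ad (V j) -> (r <= m)%N.

Definition eb_rank_is d (phi : 'M[C]_d -> 'M[C]_d) (r : nat) : Prop :=
  (exists2 V : 'I_r -> 'M[C]_d,
     forall j, \rank (V j) = 1%N & phi = \sum_j Ad (V j)) /\
  forall m (V : 'I_m -> 'M[C]_d),
    (forall j, \rank (V j) = 1%N) -> phi = \sum_j Ad (V j) -> (r <= m)%N.

Definition dephasing d (X : 'M[C]_d) : 'M[C]_d :=
  \sum_(j < d) inner (delta_mx j 0) (X *m delta_mx j 0)
    *: ketbra (delta_mx j 0) (delta_mx j 0).

Definition twisted_dephasing d (U V : 'M[C]_d) : 'M[C]_d -> 'M[C]_d :=
  Ad U \o @dephasing d \o Ad (V^t*).

End MatrixMaps.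

(* Main.v *)
(* Suppose tau = t phi + (1 - t) psi in UEBTP(d).  Applying phi to one half of
   the maximally entangled vector and decomposing the resulting separable
   matrix, phi is a sum of Ad V with V of rank one; comparing the quadratic
   forms of the Choi matrices, each such V lies in the span of the |u_k><v_k|.
   By Frobenius' rank inequality a combination of the |u_k><v_k| with s nonzero
   coefficients has rank at least 2 min(s, d) - s, which is at least 2 when
   2 <= s <= N: so V is a multiple of a single |u_k><v_k|, and
   phi = sum_k q_k Ad(|u_k><v_k|).  Unitality and trace preservation then give
   q = p by the independence hypothesis (3).  The same rank bound makes the
   |u_k><v_k| linearly independent, hence the Choi rank is N.  Twisted
   dephasing channels are the case of two orthonormal bases, N = d; to cover
   d = 1 as well, the bound N <= 2d - 2 is relaxed to N <= max(d, 2d - 2). *)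

Require Import Defs.
From HB Require Import structures.
From mathcomp Require Import all_boot all_order all_algebra.
From mathcomp Require Import boolp classical_sets functions reals.
From mathcomp Require Import ring zify.

Set Implicit Arguments.
Unset Strict Implicit.
Unset Printing Implicit Defensive.

Import Order.TTheory GRing.Theory Num.Theory.
Local Open Scope ring_scope.
Local Open Scope sesquilinear_scope.

(** * Adjoints, inner products and rank-one operators *)

Section Adjoint.
Variable C : numClosedFieldType.

Lemma adjmxE m n (A : 'M[C]_(m, n)) i j : A^t* i j = (A j i)^*.
Proof. by rewrite !mxE. Qed.

Lemma adjmxM m n p (A : 'M[C]_(m, n)) (B : 'M[C]_(n, p)) :
  (A *m B)^t* = B^t* *m A^t*.
Proof. by rewrite trmx_mul map_mxM. Qed.

Lemma adjmxB m n (A B : 'M[C]_(m, n)) : (A - B)^t* = A^t* - B^t*.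
Proof. by rewrite linearB map_mxB. Qed.

Lemma adjmxZ m n c (A : 'M[C]_(m, n)) : (c *: A)^t* = c^* *: A^t*.
Proof. by rewrite linearZ /= map_mxZ. Qed.

Lemma adjmx_tens m n p q (A : 'M[C]_(m, n)) (B : 'M[C]_(p, q)) :
  (tensmx A B)^t* = tensmx (A^t*) (B^t*).
Proof. by apply/matrixP => i j; rewrite !mxE rmorphM. Qed.

Lemma innerE d (x y : 'cV[C]_d) : inner x y = \sum_i (x i 0)^* * y i 0.
Proof. by rewrite /inner mxE; apply: eq_bigr => i _; rewrite adjmxE. Qed.

Lemma inner_mulmxE d (x y : 'cV[C]_d) (A : 'M[C]_d) :
  inner x (A *m y) = \sum_i \sum_j (x i 0)^* * A i j * y j 0.
Proof.
rewrite innerE; apply: eq_bigr => i _; rewrite mxE mulr_sumr.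
by apply: eq_bigr => j _; rewrite mulrA.
Qed.

Lemma conj_inner d (x y : 'cV[C]_d) : (inner x y)^* = inner y x.
Proof. by rewrite /inner -adjmxE adjmxM trmxCK. Qed.

Lemma inner_adjmx d (x y : 'cV[C]_d) (A : 'M[C]_d) :
  inner x (A^t* *m y) = inner (A *m x) y.
Proof. by rewrite /inner adjmxM mulmxA. Qed.

Lemma innerBr d (x y z : 'cV[C]_d) : inner x (y - z) = inner x y - inner x z.
Proof. by rewrite /inner mulmxBr !mxE. Qed.

Lemma innerZr d c (x y : 'cV[C]_d) : inner x (c *: y) = c * inner x y.
Proof. by rewrite /inner -scalemxAr mxE. Qed.

Lemma inner_sumr d (I : finType) (x : 'cV[C]_d) (y : I -> 'cV[C]_d) :
  inner x (\sum_i y i) = \sum_i inner x (y i).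
Proof. by rewrite /inner mulmx_sumr summxE. Qed.

Lemma ketbra_entry d (x y : 'cV[C]_d) i j : ketbra x y i j = x i 0 * (y j 0)^*.
Proof. by rewrite /ketbra mxE big_ord1 adjmxE. Qed.

Lemma adj_ketbra d (x y : 'cV[C]_d) : (ketbra x y)^t* = ketbra y x.
Proof. by rewrite /ketbra adjmxM trmxCK. Qed.

Lemma ketbraZl d c (x y : 'cV[C]_d) : ketbra (c *: x) y = c *: ketbra x y.
Proof. by rewrite /ketbra scalemxAl. Qed.

Lemma ketbraZr d c (x y : 'cV[C]_d) : ketbra x (c *: y) = c^* *: ketbra x y.
Proof. by rewrite /ketbra adjmxZ scalemxAr. Qed.

Lemma trace_ketbra d (A : 'M[C]_d) (x y : 'cV[C]_d) :
  \tr (ketbra x y *m A) = inner y (A *m x).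
Proof. by rewrite /ketbra -mulmxA mxtrace_mulC -mulmxA trace_mx11. Qed.

Lemma Ad_ketbra d (x y : 'cV[C]_d) X :
  Ad (ketbra x y) X = inner y (X *m y) *: ketbra x x.
Proof.
rewrite /Ad adj_ketbra /ketbra /inner -!mulmxA [X *m (_ *m _)]mulmxA.
rewrite [y^t* *m (_ *m _)]mulmxA {1}[y^t* *m _]mx11_scalar.
by rewrite mul_scalar_mx scalemxAr.
Qed.

Lemma AdZ d c (V X : 'M[C]_d) : Ad (c *: V) X = `|c| ^+ 2 *: Ad V X.
Proof.
by rewrite /Ad adjmxZ -!scalemxAl -scalemxAr scalerA -normCK.
Qed.

Lemma Ad_linear d (V : 'M[C]_d) : linear (Ad V).
Proof. by move=> c X Y; rewrite /Ad mulmxDr mulmxDl -scalemxAr -scalemxAl. Qed.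

Lemma mxtrace_inj d (A B : 'M[C]_d) :
  (forall X, \tr (A *m X) = \tr (B *m X)) -> A = B.
Proof.
have trE (D : 'M[C]_d) i j : \tr (D *m delta_mx j i) = D i j.
  rewrite -[delta_mx j i]mulmx1 -(mul_delta_mx (0 : 'I_1)) mulmx1.
  rewrite mulmxA mxtrace_mulC mulmxA -rowE -colE.
  by rewrite trace_mx11 !mxE.
by move=> AB; apply/matrixP => i j; rewrite -!trE.
Qed.

End Adjoint.

(** * Positive semidefinite matrices and their rank-one decompositions *)

Section Psd.
Variable C : numClosedFieldType.

(** Spectral theorem, with each eigenvalue written as the value of the quadratic form at its unit
    eigenvector, so that information on the form passes directly to the coefficients. *)
Lemma normal_decomp n (A : 'M[C]_n) : A \is normalmx ->
  exists x : 'I_n -> 'cV[C]_n,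
    A = \sum_i inner (x i) (A *m x i) *: ketbra (x i) (x i).
Proof.
move=> /orthomx_spectralP; set P := spectralmx A; set w := spectral_diag A.
have Pu : P \is unitarymx := spectral_unitarymx A.
rewrite invmx_unitary // => A_PwP; exists (fun i => col i (P^t*)).
have wE i : inner (col i (P^t*)) (A *m col i (P^t*)) = w 0 i.
  rewrite /inner A_PwP colE adjmxM trmxCK -!mulmxA [P *m (_ *m _)]mulmxA.
  rewrite (unitarymxP Pu) mul1mx [P *m _]mulmxA (unitarymxP Pu) mul1mx.
  rewrite -colE mxE (bigD1 i) //= big1 ?addr0 => [|j /negPf ji].
    by rewrite !mxE !eqxx conjC1 mul1r mulr1n.
  by rewrite !mxE ji conjC0 mul0r.
apply/matrixP => a b; rewrite {1}A_PwP mul_mx_diag mxE summxE.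
apply: eq_bigr => i _; rewrite wE !mxE big_ord1 !mxE conjCK.
by rewrite mulrCA mulrA mulrAC.
Qed.

(** The difference [K] of [A^t*] and [A] is anti-Hermitian, hence normal; its eigenvalues are the
    conjugate of a real number minus that number, so they all vanish. *)
Lemma psd_adj n (A : 'M[C]_n) : psd A -> A^t* = A.
Proof.
move=> psdA; apply/eqP; rewrite -subr_eq0; set K := _ - _.
have KN : K^t* = - K by rewrite adjmxB trmxCK opprB.
have nK : K \is normalmx by apply/normalmxP; rewrite KN mulmxN mulNmx.
have [x ->] := normal_decomp nK; rewrite big1 // => i _.
rewrite mulmxBl innerBr inner_adjmx -conj_inner.
by rewrite (CrealP (ger0_real (psdA _))) subrr scale0r.
Qed.

(** The eigenvectors absorb the square roots of the nonnegative eigenvalues. *)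
Lemma psd_decomp n (A : 'M[C]_n) : psd A ->
  exists x : 'I_n -> 'cV[C]_n, A = \sum_i ketbra (x i) (x i).
Proof.
move=> psdA; have nA : A \is normalmx by apply/normalmxP; rewrite psd_adj.
have [x {1}->] := normal_decomp nA.
exists (fun i => sqrtC (inner (x i) (A *m x i)) *: x i).
apply: eq_bigr => i _; rewrite ketbraZl ketbraZr scalerA -normCK.
by rewrite ger0_norm ?sqrtC_ge0 // sqrtCK.
Qed.

Lemma psd_ketbra n (x : 'cV[C]_n) : psd (ketbra x x).
Proof.
by move=> z; rewrite ketbraE innerZr -conj_inner mulrC -normCK exprn_ge0.
Qed.

Lemma psd_sum n (I : finType) (A : I -> 'M[C]_n) :
  (forall i, psd (A i)) -> psd (\sum_i A i).
Proof.
by move=> psdA x; rewrite mulmx_suml inner_sumr sumr_ge0 // => i _; exact: psdA.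
Qed.

Lemma psdZ n c (A : 'M[C]_n) : 0 <= c -> psd A -> psd (c *: A).
Proof. by move=> c0 psdA x; rewrite -scalemxAl innerZr mulr_ge0. Qed.

Lemma tens_ketbra m n (x x' : 'cV[C]_m) (y y' : 'cV[C]_n) :
  tensmx (ketbra x x') (ketbra y y') =
  ketbra (tensmx x y : 'cV[C]_(m * n)) (tensmx x' y').
Proof. by rewrite /ketbra (adjmx_tens x' y') -(tensmx_mul x y). Qed.

Lemma psd_tens m n (A : 'M[C]_m) (B : 'M[C]_n) :
  psd A -> psd B -> psd (tensmx A B).
Proof.
move=> /psd_decomp[x ->] /psd_decomp[y ->].
have -> : tensmx (\sum_i ketbra (x i) (x i)) (\sum_j ketbra (y j) (y j)) =
   \sum_i \sum_j tensmx (ketbra (x i) (x i)) (ketbra (y j) (y j)).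
  apply/matrixP => r s; rewrite mxE !summxE mulr_suml.
  apply: eq_bigr => i _; rewrite mulr_sumr summxE.
  by apply: eq_bigr => j _; rewrite [in RHS]mxE.
by do 2!apply: psd_sum => ?; rewrite tens_ketbra; exact: psd_ketbra.
Qed.

Lemma separable_psd d k (Z : 'M[C]_(d * k)) : separable Z -> psd Z.
Proof.
by move=> [m [X [Y [pX pY ->]]]]; apply: psd_sum => j; apply: psd_tens.
Qed.

End Psd.

(** * Rank-one Kraus decompositions of entanglement breaking maps *)

Section EntanglementBreaking.
Variable C : numClosedFieldType.

Lemma linear_sum_fun (U V : lmodType C) (phi : U -> V) : linear phi ->
  forall (I : finType) (c : I -> C) (x : I -> U),
  phi (\sum_i c i *: x i) = \sum_i c i *: phi (x i).
Proof.
move=> phiL I c x; have phi0 : phi 0 = 0.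
  by have := phiL (-1) 0 0; rewrite !scaleN1r !addNr.
by elim/big_rec2: _ => [//|i y z _ <-]; rewrite phiL.
Qed.

Lemma tens_block_id d k (phi : 'M[C]_d -> 'M[C]_d) (Z : 'M[C]_(d * k)) a b :
  tens_block (tens_id phi Z) a b = phi (tens_block Z a b).
Proof.
apply/matrixP => i j; rewrite mxE /tens_id.
rewrite summxE (bigD1 a) //= summxE (bigD1 b) //=.
rewrite tensmxE !mxE !eqxx mulr1 big1 ?addr0 => [|b' nb].
  rewrite big1 ?addr0 // => a' na; rewrite summxE big1 // => b' _.
  by rewrite tensmxE !mxE eq_sym (negPf na) mulr0.
by rewrite tensmxE !mxE [b == _]eq_sym (negPf nb) andbF mulr0.
Qed.

Lemma tens_block_tens d k (X : 'M[C]_d) (Y : 'M[C]_k) a b :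
  tens_block (tensmx X Y) a b = Y a b *: X.
Proof. by apply/matrixP => i j; rewrite !mxE !mxtens_indexK mulrC. Qed.

Lemma tens_block_sum d k (I : finType) (Z : I -> 'M[C]_(d * k)) a b :
  tens_block (\sum_i Z i) a b = \sum_i tens_block (Z i) a b.
Proof.
apply/matrixP => i j; rewrite !mxE !summxE.
by apply: eq_bigr => l _; rewrite mxE.
Qed.

Lemma tens_block_inj d k (Z W : 'M[C]_(d * k)) :
  (forall a b, tens_block Z a b = tens_block W a b) -> Z = W.
Proof.
move=> ZW; apply/matrixP => r s.
case: (mxtens_indexP r) => i a; case: (mxtens_indexP s) => j b.
by have /matrixP/(_ i j) := ZW a b; rewrite !mxE.
Qed.

Lemma big_mxtens_index d k (F : 'I_(d * k) -> C) :
  \sum_r F r = \sum_i \sum_a F (mxtens_index (i, a)).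
Proof.
rewrite pair_bigA; apply: reindex; exists (@mxtens_unindex d k) => r _ /=.
  by case: r => i a; rewrite mxtens_indexK.
by rewrite -[RHS]mxtens_unindexK.
Qed.

(** The entrywise pairing is the trace of a product with one factor transposed; transposing
    [ketbra x x] conjugates [x], whence the conjugates on the right. *)
Lemma inner_sum_ketbra n (I : finType) (x : I -> 'cV[C]_n) (M : 'M[C]_n) :
  \sum_a \sum_b M a b * (\sum_i ketbra (x i) (x i)) a b =
  \sum_i inner (map_mx Num.conj (x i)) (M *m map_mx Num.conj (x i)).
Proof.
under [RHS]eq_bigr => i _ do rewrite inner_mulmxE.
rewrite [RHS]exchange_big; apply: eq_bigr => a _ /=.
rewrite [RHS]exchange_big; apply: eq_bigr => b _ /=.
rewrite summxE mulr_sumr; apply: eq_bigr => i _.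
by rewrite ketbra_entry !mxE conjCK mulrCA mulrA.
Qed.

Lemma entanglement_breaking_kraus d (phi : 'M[C]_d -> 'M[C]_d) : (0 < d)%N ->
  entanglement_breaking phi ->
  exists (J : finType) (x y : J -> 'cV[C]_d),
    forall X, phi X = \sum_j Ad (ketbra (x j) (y j)) X.
Proof.
move=> d0 [phiL phiEB].
(* The unnormalised maximally entangled vector, the sum of all e_i (x) e_i. The blocks of its
   projector are the matrix units, so [tens_id phi] turns it into the Choi matrix of [phi]. *)
pose Omega : 'cV[C]_(d * d) :=
  \col_r ((mxtens_unindex r).1 == (mxtens_unindex r).2)%:R.
have blockO a b : tens_block (ketbra Omega Omega) a b = delta_mx a b.
  apply/matrixP => i j.
  by rewrite mxE ketbra_entry !mxE !mxtens_indexK /= conjC_nat -natrM mulnb.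
have [m [P [Q [psdP psdQ phiE]]]] := phiEB d _ d0 (psd_ketbra Omega).
have {}phiE a b : phi (delta_mx a b) = \sum_j Q j a b *: P j.
  rewrite -blockO -tens_block_id phiE tens_block_sum.
  by apply: eq_bigr => j _; rewrite tens_block_tens.
have [x xE] := choice (fun j => psd_decomp (psdP j)).
have [y yE] := choice (fun j => psd_decomp (psdQ j)).
(* An index consists of a separable term [j], a rank-one piece of [P j] and one of [Q j]. By
   linearity [phi X] is the sum over [j] of [P j] weighted by the entrywise pairing of [X] with
   [Q j]. *)
exists ('I_m * 'I_d * 'I_d)%type, (fun t => x t.1.1 t.1.2),
  (fun t => map_mx Num.conj (y t.1.1 t.2)) => X.
under eq_bigr => t _ do rewrite Ad_ketbra.
rewrite -(pair_bigA _ (fun t l => inner (map_mx Num.conj (y t.1 l))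
  (X *m map_mx Num.conj (y t.1 l)) *: ketbra (x t.1 t.2) (x t.1 t.2))) /=.
rewrite -(pair_bigA _ (fun j i => \sum_l inner (map_mx Num.conj (y j l))
  (X *m map_mx Num.conj (y j l)) *: ketbra (x j i) (x j i))) /=.
under [RHS]eq_bigr => j _ do
  under eq_bigr => i _ do rewrite -scaler_suml -inner_sum_ketbra -yE.
under [RHS]eq_bigr => j _ do rewrite -scaler_sumr -xE.
rewrite {1}[X]matrix_sum_delta pair_bigA linear_sum_fun //=.
under eq_bigr => t _ do rewrite phiE scaler_sumr.
rewrite exchange_big; apply: eq_bigr => j _.
rewrite pair_bigA scaler_suml.
by apply: eq_bigr => t _; rewrite scalerA.
Qed.

(** * Weighted sums of rank-one Kraus maps *)

Section RankOneSum.
Variables (d N : nat) (u v : 'I_N -> 'cV[C]_d) (p : 'I_N -> C).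
Let tau : 'M[C]_d -> 'M[C]_d := \sum_k p k *: Ad (ketbra (u k) (v k)).

Lemma sum_AdE X : tau X = \sum_k p k *: Ad (ketbra (u k) (v k)) X.
Proof. by rewrite /tau fct_sumE. Qed.

Lemma sum_Ad_ketbraE X :
  tau X = \sum_k (p k * inner (v k) (X *m v k)) *: ketbra (u k) (u k).
Proof.
by rewrite sum_AdE; apply: eq_bigr => k _; rewrite Ad_ketbra scalerA.
Qed.

Lemma sum_Ad_linear : linear tau.
Proof.
move=> c X Y; rewrite !sum_AdE scaler_sumr -big_split; apply: eq_bigr => k _ /=.
by rewrite Ad_linear scalerDr !scalerA [c * _]mulrC.
Qed.

Hypothesis u1 : forall k, inner (u k) (u k) = 1.
Hypothesis v1 : forall k, inner (v k) (v k) = 1.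

(** The weights carry no sign condition here: in the extremality argument they are the unknown
    coefficients [q] of a component of the channel. *)
Lemma sum_Ad_unit : tau 1%:M = \sum_k p k *: ketbra (u k) (u k).
Proof.
by rewrite sum_Ad_ketbraE; apply: eq_bigr => k _; rewrite mul1mx v1 mulr1.
Qed.

Lemma sum_Ad_trace X :
  \tr (tau X) = \tr ((\sum_k p k *: ketbra (v k) (v k)) *m X).
Proof.
rewrite sum_Ad_ketbraE mulmx_suml !linear_sum; apply: eq_bigr => k _ /=.
rewrite -scalemxAl !linearZ /= trace_ketbra -[ketbra (u k) _]mulmx1.
by rewrite trace_ketbra mul1mx u1 mulr1.
Qed.

Hypothesis p0 : forall k, 0 <= p k.

Lemma sum_Ad_ketbra_EB : entanglement_breaking tau.
Proof.
split=> [|k Z _ Zpsd]; first exact: sum_Ad_linear.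
(* Measure and prepare: [Y j] is the contraction of the first tensor factor of [Z] against [v j],
   while [u j] is prepared in that factor. *)
pose Y j : 'M[C]_k := \matrix_(a, b) inner (v j) (tens_block Z a b *m v j).
exists N, (fun j => ketbra (u j) (u j)), (fun j => p j *: Y j).
split=> [j|j|]; first exact: psd_ketbra.
  (* The form of [Y j] at [w] equals the form of [Z] at the product vector of [v j] and [w]. *)
  apply: psdZ => // w; have := Zpsd (tensmx (v j) w : 'cV[C]_(d * k)).
  congr (0 <= _); rewrite !inner_mulmxE big_mxtens_index exchange_big.
  apply: eq_bigr => a _.
  under eq_bigr => i _ do rewrite big_mxtens_index exchange_big.
  rewrite exchange_big; apply: eq_bigr => b _.
  rewrite mxE inner_mulmxE mulr_sumr mulr_suml; apply: eq_bigr => i _.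
  rewrite mulr_sumr mulr_suml; apply: eq_bigr => l _.
  rewrite -(ord1 ((mxtens_unindex (0 : 'I_(1 * 1))).1)) !mxE !mxtens_indexK /=.
  rewrite !ord1 rmorphM /=; ring.
apply: tens_block_inj => a b.
rewrite tens_block_id tens_block_sum sum_Ad_ketbraE.
by apply: eq_bigr => j _; rewrite tens_block_tens !mxE.
Qed.

(** The resolution of the identity by the [u k] gives unitality, the one by the [v k] trace
    preservation; complete positivity holds because separable matrices are positive semidefinite. *)
Lemma sum_Ad_ketbra_UEBTP :
  \sum_k p k *: ketbra (u k) (u k) = 1%:M ->
  \sum_k p k *: ketbra (v k) (v k) = 1%:M -> UEBTP tau.
Proof.
move=> uI vI; have tauEB := sum_Ad_ketbra_EB; split=> //; last first.
  by rewrite sum_Ad_unit uI.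
split=> [|X]; last by rewrite sum_Ad_trace vI mul1mx.
split=> [|k Z k0 psdZ]; first exact: sum_Ad_linear.
by case: tauEB => _ tauEB; apply/separable_psd/tauEB.
Qed.

End RankOneSum.
End EntanglementBreaking.

(** * Comparison of Kraus operators through Choi forms *)

Section KrausSpan.
Variable C : numClosedFieldType.

(* <A, J A> for the Choi matrix J of phi, with A viewed as a vector. *)
Definition choi_form d (phi : 'M[C]_d -> 'M[C]_d) (A : 'M[C]_d) : C :=
  \sum_a \sum_b (A^t* *m phi (delta_mx a b) *m A) a b.

(** The Choi matrix of [Ad V] is the rank-one operator of [V] seen as a vector, so its form is the
    squared modulus of a Hilbert-Schmidt product. *)
Lemma choi_form_Ad d (V A : 'M[C]_d) :
  choi_form (Ad V) A = `|\tr (A^t* *m V)| ^+ 2.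
Proof.
rewrite normCK /choi_form /mxtrace rmorph_sum mulr_suml.
apply: eq_bigr => a _; rewrite mulr_sumr; apply: eq_bigr => b _.
have -> : A^t* *m Ad V (delta_mx a b) *m A =
    col a (A^t* *m V) *m row b ((A^t* *m V)^t*).
  rewrite colE rowE -[delta_mx a b](mul_delta_mx (0 : 'I_1)) /Ad.
  by rewrite adjmxM trmxCK !mulmxA.
by rewrite mxE big_ord1 [col _ _ _ _]mxE [row _ _ _ _]mxE adjmxE.
Qed.

Lemma choi_form_sum d (I : finType) (c : I -> C)
    (phi : I -> 'M[C]_d -> 'M[C]_d) (psi : 'M[C]_d -> 'M[C]_d) A :
  (forall X, psi X = \sum_i c i *: phi i X) ->
  choi_form psi A = \sum_i c i * choi_form (phi i) A.
Proof.
move=> psiE; rewrite /choi_form.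
under [RHS]eq_bigr => i _ do rewrite mulr_sumr.
rewrite [RHS]exchange_big; apply: eq_bigr => a _ /=.
under [RHS]eq_bigr => i _ do rewrite mulr_sumr.
rewrite [RHS]exchange_big; apply: eq_bigr => b _ /=.
rewrite psiE mulmx_sumr mulmx_suml summxE; apply: eq_bigr => i _.
by rewrite -scalemxAr -scalemxAl mxE.
Qed.

(** A double orthogonal complement argument for the Hilbert-Schmidt product. *)
Lemma mem_span_trace d N (T : 'I_N -> 'M[C]_d) (V : 'M[C]_d) :
  (forall A, (forall k, \tr (A^t* *m T k) = 0) -> \tr (A^t* *m V) = 0) ->
  exists c : 'I_N -> C, V = \sum_k c k *: T k.
Proof.
move=> orthV; pose M := \matrix_k mxvec (T k).
suff /submxP[D VD] : (mxvec V <= M)%MS.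
  exists (D 0); apply: (can_inj mxvecK); rewrite VD mulmx_sum_row linear_sum.
  by apply: eq_bigr => k _; rewrite linearZ rowK.
(* Pairing with [A j] computes the product with column [j] of the cokernel of [M], and the common
   kernel of these columns is the row space of [M]. *)
pose A j : 'M[C]_d := \matrix_(a, b) (cokermx M (mxvec_index a b) j)^*.
have trA j (W : 'M[C]_d) :
    \tr ((A j)^t* *m W) = (mxvec W *m cokermx M) 0 j.
  have -> : (mxvec W *m cokermx M) 0 j =
      \sum_a \sum_b W a b * cokermx M (mxvec_index a b) j.
    rewrite mxE pair_bigA (reindex _ (curry_mxvec_bij _ _)).
    by apply: eq_bigr => -[a b] _; rewrite mxvecE.
  rewrite exchange_big /=.
  apply: eq_bigr => b _; rewrite mxE; apply: eq_bigr => a _.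
  by rewrite !mxE conjCK mulrC.
rewrite submxE; apply/eqP/rowP => j; rewrite -trA mxE; apply: orthV => k.
rewrite trA; have := congr1 (row k) (mulmx_coker M).
by rewrite row_mul rowK row0 => ->; rewrite mxE.
Qed.

(** If [A] is orthogonal to every [T k], the Choi form of the left side vanishes at [A]. The right
    side is then a vanishing sum of nonnegative terms, so [A] is orthogonal to every [V i]. *)
Lemma kraus_span d N (I J : finType) (T : 'I_N -> 'M[C]_d) (p : 'I_N -> C)
    (V : I -> 'M[C]_d) (W : J -> 'M[C]_d) (t s : C) :
  0 < t -> 0 <= s ->
  (forall X, \sum_k p k *: Ad (T k) X =
     t *: (\sum_i Ad (V i) X) + s *: (\sum_j Ad (W j) X)) ->
  forall i, exists c : 'I_N -> C, V i = \sum_k c k *: T k.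
Proof.
move=> t0 s0 eqX i; apply: mem_span_trace => A orthA.
have formV (K : finType) (U : K -> 'M[C]_d) :
    choi_form (fun X => \sum_k Ad (U k) X) A = \sum_k `|\tr (A^t* *m U k)| ^+ 2.
  rewrite (@choi_form_sum _ _ (fun=> 1) (fun k => Ad (U k))).
    by apply: eq_bigr => k _; rewrite mul1r choi_form_Ad.
  by move=> X; apply: eq_bigr => k _; rewrite scale1r.
have := erefl (choi_form (fun X => \sum_k p k *: Ad (T k) X) A).
rewrite {1}(@choi_form_sum _ _ p (fun k => Ad (T k))) // big1; last first.
  by move=> k _; rewrite choi_form_Ad orthA normr0 expr0n mulr0.
(* The two-term combination is read as a sum over [bool]. *)
rewrite (@choi_form_sum _ _ (fun b : bool => if b then t else s)
  (fun b X => if b then \sum_i Ad (V i) X else \sum_j Ad (W j) X)); last first.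
  by move=> X; rewrite eqX big_bool.
rewrite big_bool !formV => /esym/eqP.
have sum_ge0 (K : finType) (U : K -> 'M[C]_d) :
    0 <= \sum_k `|\tr (A^t* *m U k)| ^+ 2.
  by apply: sumr_ge0 => k _; rewrite exprn_ge0.
rewrite paddr_eq0 ?(mulr_ge0 (ltW t0)) ?(mulr_ge0 s0) // => /andP[+ _].
rewrite mulf_eq0 gt_eqF //= psumr_eq0 => [|k _]; last by rewrite exprn_ge0.
by move=> /allP/(_ i (mem_index_enum _)); rewrite expf_eq0 normr_eq0 => /eqP.
Qed.

(** With positive weights the orthogonality argument also runs the other way: each [T k] lies in the
    span of the [V j], and [N] independent matrices cannot lie in the span of fewer than [N]. *)
Lemma kraus_count d N m (T : 'I_N -> 'M[C]_d) (p : 'I_N -> C)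
    (V : 'I_m -> 'M[C]_d) :
  (forall k, 0 < p k) ->
  (forall X, \sum_k p k *: Ad (T k) X = \sum_j Ad (V j) X) ->
  (forall c : 'I_N -> C, \sum_k c k *: T k = 0 -> forall k, c k = 0) ->
  (N <= m)%N.
Proof.
move=> p0 TV indepT.
have spanT k : exists c : 'I_m -> C, T k = \sum_j c j *: V j.
  apply: mem_span_trace => A orthA.
  have := @choi_form_sum _ _ p (fun k => Ad (T k)) _ A (fun=> erefl).
  rewrite (@choi_form_sum _ _ (fun=> 1) (fun j => Ad (V j))); last first.
    by move=> X; rewrite TV; apply: eq_bigr => j _; rewrite scale1r.
  rewrite big1 => [/esym/eqP|j _]; last first.
    by rewrite choi_form_Ad orthA normr0 expr0n mulr0.
  rewrite psumr_eq0 => [/allP/(_ k (mem_index_enum _))|l _]; last first.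
    by rewrite choi_form_Ad mulr_ge0 ?exprn_ge0 // ltW.
  by rewrite mulf_eq0 gt_eqF //= choi_form_Ad expf_eq0 normr_eq0 => /eqP.
have [c cE] := choice spanT; pose M := \matrix_(k < N, j < m) c k j.
(* A left kernel vector of the coefficient matrix would be a linear relation between the [T k]. *)
rewrite -(eqP (_ : row_free M)) ?rank_leq_col //.
apply: inj_row_free => r rM; apply/rowP => k; rewrite mxE.
apply: (indepT (fun k => r 0 k)).
under eq_bigr => l _ do rewrite cE scaler_sumr.
rewrite exchange_big big1 // => j _ /=.
under eq_bigr => l _ do rewrite scalerA.
rewrite -scaler_suml; have /rowP/(_ j) := rM; rewrite !mxE => rMj.
rewrite (_ : \sum_i _ = 0) ?scale0r // -[RHS]rMj.
by apply: eq_bigr => l _; rewrite mxE.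
Qed.

End KrausSpan.

(** * Rank bounds for vectors in general position *)

Section GeneralPosition.
Variable C : numClosedFieldType.

(** Subfamilies of at most [d] vectors are used, not exactly [d], so that the property keeps its
    content for families with fewer than [d] members and passes to subfamilies. *)
Definition general_position s d (w : 'I_s -> 'cV[C]_d) : Prop :=
  forall m (h : 'I_m -> 'I_s), injective h -> (m <= d)%N ->
  forall a : 'I_m -> C, \sum_i a i *: w (h i) = 0 -> forall i, a i = 0.

Lemma general_position_comp s t d (w : 'I_s -> 'cV[C]_d) (f : 'I_t -> 'I_s) :
  injective f -> general_position w -> general_position (w \o f).
Proof.
by move=> f_inj gw m h h_inj; apply: (gw m (f \o h)); apply: inj_comp.
Qed.

Lemma general_positionZ s d (w : 'I_s -> 'cV[C]_d) (c : 'I_s -> C) :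
  (forall k, c k != 0) ->
  general_position w -> general_position (fun k => c k *: w k).
Proof.
move=> c0 gw m h h_inj md a; under eq_bigr => i _ do rewrite scalerA.
move=> /(gw m h h_inj md (fun i => a i * c (h i))) ac i.
by apply/eqP; have /eqP := ac i; rewrite mulf_eq0 (negPf (c0 _)) orbF.
Qed.

Lemma general_position_conj s d (w : 'I_s -> 'cV[C]_d) :
  general_position w -> general_position (fun k => map_mx Num.conj (w k)).
Proof.
move=> gw m h h_inj md a aw0 i; apply/eqP; rewrite -conjC_eq0; apply/eqP.
apply: (gw m h h_inj md (fun i => (a i)^*)).
have /(congr1 (map_mx Num.conj)) := aw0; rewrite map_mx0 => E; rewrite -[RHS]E.
apply/matrixP => r q; rewrite mxE !summxE rmorph_sum.
by apply: eq_bigr => l _; rewrite !mxE rmorphM /= conjCK.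
Qed.

Lemma general_position_rank s d (w : 'I_s -> 'cV[C]_d) :
  general_position w -> (minn s d <= \rank (\matrix_k (w k)^T))%N.
Proof.
move=> gw; pose g : 'I_(minn s d) -> 'I_s := widen_ord (geq_minl s d).
apply: leq_trans (mxrankS (rowsub_sub g _)).
rewrite (eqP (_ : row_free _)) //; apply: inj_row_free => r rg.
apply/rowP => k; rewrite mxE.
apply: (gw _ g) (geq_minr s d) (fun k => r 0 k) _ _.
  by move=> i j /(congr1 val) /= ij; apply: val_inj.
have /(congr1 trmx) := rg; rewrite trmx0 mulmx_sum_row linear_sum => E.
rewrite -[RHS]E.
by apply: eq_bigr => l _; rewrite linearZ /= row_rowsub rowK trmxK.
Qed.

Lemma rank_sum_ketbra d N (u v : 'I_N -> 'cV[C]_d) (c : 'I_N -> C) :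
  general_position u -> general_position v ->
  ((minn #|[set k | c k != 0%R]| d).*2 <=
   #|[set k | c k != 0%R]| + \rank (\sum_k c k *: ketbra (u k) (v k))%R)%N.
Proof.
move=> gu gv; set S := [set k | _]; set s := #|S|.
pose f : 'I_s -> 'I_N := @enum_val _ (mem S).
have f_inj : injective f := enum_val_inj.
have c0 i : c (f i) != 0 by have := enum_valP i; rewrite inE.
pose A := \matrix_i ((u \o f) i)^T.
(* On the support of [c] the combination factors as [A^T *m B]; the coefficients and the conjugation
   from the bra go into the rows of [B]. *)
pose w i := c (f i) *: map_mx Num.conj ((v \o f) i).
pose B := \matrix_i (w i)^T.
have -> : \sum_k c k *: ketbra (u k) (v k) = A^T *m B.
  rewrite (bigID (mem S)) /= addrC big1 ?add0r => [|k]; last first.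
    by rewrite inE negbK => /eqP->; rewrite scale0r.
  rewrite big_enum_val; apply/matrixP => a b; rewrite summxE mxE.
  by apply: eq_bigr => i _; rewrite mxE ketbra_entry !mxE mulrCA.
have gw : general_position w.
  apply: general_positionZ => //; apply: general_position_conj.
  exact: general_position_comp.
(* The middle factor is the identity of size [s], which contributes the support size to the bound;
   both outer factors have rank at least [minn s d]. *)
have := mxrank_Frobenius A^T 1%:M B; rewrite mulmx1 mul1mx mxrank1 mxrank_tr.
apply: leq_trans; rewrite -addnn leq_add //; last exact: general_position_rank.
exact/general_position_rank/general_position_comp.
Qed.

Section SmallFamily.
Variables (d N : nat) (u v : 'I_N -> 'cV[C]_d).
Hypotheses (d0 : (0 < d)%N) (Nd : (N <= maxn d (2 * d - 2))%N).
Hypotheses (gu : general_position u) (gv : general_position v).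

Lemma ketbra_indep c :
  \sum_k c k *: ketbra (u k) (v k) = 0 -> forall k : 'I_N, c k = 0.
Proof.
move=> cuv k; apply/eqP; apply: contraT => ck.
have := rank_sum_ketbra c gu gv; rewrite cuv mxrank0.
have := max_card (mem [set k | c k != 0]); rewrite card_ord.
have : (0 < #|[set k | c k != 0%R]|)%N.
  by apply/card_gt0P; exists k; rewrite inE.
(* Rank 0 forces 2 min(s, d) <= s, so s >= 2d when s > 0, against the bound on [N]. *)
move: #|_| Nd d0 => s; lia.
Qed.

Lemma ketbra_span c (x y : 'cV[C]_d) : (0 < N)%N ->
  ketbra x y = \sum_k c k *: ketbra (u k) (v k) ->
  exists k, ketbra x y = c k *: ketbra (u k) (v k).
Proof.
move=> N0 xyE; have : (#|[set k | c k != 0%R]| <= 1)%N.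
  have := rank_sum_ketbra c gu gv; rewrite -xyE.
  have := leq_trans (mxrankM_maxl x (y^t*)) (rank_leq_col x).
  have := max_card (mem [set k | c k != 0]); rewrite card_ord -/(ketbra x y).
  (* Rank at most 1 forces 2 min(s, d) <= s + 1. If s >= 2 then s >= 2d - 1 and s > d, against the
     bound on [N]. *)
  move: #|_| (\rank _) Nd d0 => s r; lia.
have [/eqP|] := posnP #|[set k | c k != 0%R]|.
  (* With empty support the operator is zero, and any index serves. *)
  rewrite cards_eq0 => /eqP/setP c0 _; exists (Ordinal N0).
  have {}c0 k : c k = 0 by have := c0 k; rewrite !inE => /negbFE/eqP.
  by rewrite xyE c0 scale0r big1 // => k _; rewrite c0 scale0r.
rewrite card_gt0 => /set0Pn[k kS] /card_le1_eqP c1; exists k.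
rewrite xyE (bigD1 k) //= big1 ?addr0 // => l lk.
apply/eqP; rewrite scaler_eq0; apply/orP; left; apply: contraNT lk => cl.
by apply/eqP; apply: c1 => //; rewrite inE.
Qed.

End SmallFamily.
End GeneralPosition.

(** * Extremality and ranks of the channel *)

Section Extremality.
Variables (C : numClosedFieldType) (d N : nat) (u v : 'I_N -> 'cV[C]_d).
Variable p : 'I_N -> C.
Hypotheses (d0 : (0 < d)%N) (dN : (d <= N)%N).
Hypothesis Nd : (N <= maxn d (2 * d - 2))%N.
Hypothesis u1 : forall k, inner (u k) (u k) = 1.
Hypothesis v1 : forall k, inner (v k) (v k) = 1.
Hypothesis p0 : forall k, 0 < p k.
Hypothesis uI : \sum_k p k *: ketbra (u k) (u k) = 1%:M.
Hypothesis vI : \sum_k p k *: ketbra (v k) (v k) = 1%:M.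
Hypotheses (gu : general_position u) (gv : general_position v).

Let tau : 'M[C]_d -> 'M[C]_d := \sum_k p k *: Ad (ketbra (u k) (v k)).

Lemma EB_dominated_sum (phi psi : 'M[C]_d -> 'M[C]_d) t s :
  entanglement_breaking phi -> entanglement_breaking psi -> 0 < t -> 0 <= s ->
  tau = t *: phi + s *: psi ->
  exists q : 'I_N -> C, phi = \sum_k q k *: Ad (ketbra (u k) (v k)).
Proof.
move=> /(entanglement_breaking_kraus d0)[I [x [y phiE]]].
move=> /(entanglement_breaking_kraus d0)[J [z [w psiE]]] t0 s0 tauE.
have eqX X : \sum_k p k *: Ad (ketbra (u k) (v k)) X =
    t *: (\sum_i Ad (ketbra (x i) (y i)) X)
    + s *: (\sum_j Ad (ketbra (z j) (w j)) X).
  by rewrite -phiE -psiE -sum_AdE -/tau tauE.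
have cE i : exists kc : 'I_N * C,
    ketbra (x i) (y i) = kc.2 *: ketbra (u kc.1) (v kc.1).
  have [c /(ketbra_span d0 Nd gu gv (leq_trans d0 dN))[k xyE]] :=
    kraus_span t0 s0 eqX i.
  by exists (k, c k).
have {cE}[g gE] := choice cE.
(* The Kraus operators of [phi] are grouped by the index of the [ketbra] to which they are
   proportional; a scalar enters [Ad] through its squared modulus. *)
exists (fun k => \sum_(i | (g i).1 == k) `|(g i).2| ^+ 2).
apply/funext => X; rewrite phiE sum_AdE.
rewrite (partition_big (fun i => (g i).1) predT) //=.
apply: eq_bigr => k _; rewrite scaler_suml.
by apply: eq_bigr => i /eqP <-; rewrite gE AdZ.
Qed.

Hypothesis uv_indep : forall a : 'I_N -> C,
  \sum_k a k *: ketbra (u k) (u k) = 0 ->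
  \sum_k a k *: ketbra (v k) (v k) = 0 -> forall k, a k = 0.

(** Only one component is identified, with general weights, so that exchanging the two components
    settles the other. *)
Lemma UEBTP_dominated (phi psi : 'M[C]_d -> 'M[C]_d) t s :
  UEBTP phi -> UEBTP psi -> 0 < t -> 0 <= s -> tau = t *: phi + s *: psi ->
  phi = tau.
Proof.
move=> [[_ phiTP] phi1 phiEB] [_ _ psiEB] t0 s0 tauE.
have [q phiE] := EB_dominated_sum phiEB psiEB t0 s0 tauE.
suff qp k : q k = p k by rewrite phiE; apply: eq_bigr => k _; rewrite qp.
apply/eqP; rewrite -subr_eq0; apply/eqP.
apply: (uv_indep (a := fun k => q k - p k)).
  under eq_bigr => l _ do rewrite scalerBl.
  by rewrite sumrB uI -(sum_Ad_unit u q v1) -phiE phi1 subrr.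
under eq_bigr => l _ do rewrite scalerBl.
rewrite sumrB vI; apply/eqP; rewrite subr_eq0; apply/eqP/mxtrace_inj => X.
by rewrite -(sum_Ad_trace v q u1) -phiE phiTP mul1mx.
Qed.

Lemma tau_extreme : extreme_point (@UEBTP C d) tau.
Proof.
split=> [|phi psi t phiU psiU /andP[t0 t1] tauE].
  by apply: sum_Ad_ketbra_UEBTP => // k; exact: ltW.
have s0 : 0 < 1 - t by rewrite subr_gt0.
split; first exact: UEBTP_dominated phiU psiU t0 (ltW s0) tauE.
by apply: UEBTP_dominated psiU phiU s0 (ltW t0) _; rewrite addrC.
Qed.

Lemma tau_kraus :
  tau = \sum_k Ad (sqrtC (p k) *: ketbra (u k) (v k)).
Proof.
apply/funext => X; rewrite /tau sum_AdE fct_sumE; apply: eq_bigr => k _.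
by rewrite AdZ ger0_norm ?sqrtCK // sqrtC_ge0 ltW.
Qed.

(** This bound serves both ranks, since a representation by rank-one matrices is a Kraus
    representation. *)
Lemma tau_kraus_min m (V : 'I_m -> 'M[C]_d) :
  tau = \sum_j Ad (V j) -> (N <= m)%N.
Proof.
move=> tauV; apply: (kraus_count (V := V) p0 _ (ketbra_indep d0 Nd gu gv)) => X.
by rewrite -sum_AdE -/tau tauV fct_sumE.
Qed.

Lemma tau_choi_rank : choi_rank_is tau N.
Proof.
split; last exact: tau_kraus_min.
by exists (fun k => sqrtC (p k) *: ketbra (u k) (v k)); exact: tau_kraus.
Qed.

Lemma tau_eb_rank : eb_rank_is tau N.
Proof.
split; last by move=> m V _; exact: tau_kraus_min.
exists (fun k => sqrtC (p k) *: ketbra (u k) (v k)); last exact: tau_kraus.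
move=> k; rewrite mxrank_scale_nz ?sqrtC_eq0 ?gt_eqF //.
apply/eqP; rewrite eqn_leq (leq_trans (mxrankM_maxl _ _) (rank_leq_col _)) /=.
rewrite lt0n mxrank_eq0; apply/eqP => uv0.
(* The operator is nonzero because its matrix coefficient between [u k] and [v k] is 1. *)
have := congr1 (fun A => inner (u k) (A *m v k)) uv0.
rewrite ketbraE innerZr u1 v1 mul0mx innerE big1 => [/eqP|i _].
  by rewrite mulr1 oner_eq0.
by rewrite mxE mulr0.
Qed.

End Extremality.

(** * From freeness of sequences to vanishing coefficients *)

Section Free.
Variables (C : numClosedFieldType).

Lemma free_map_sum0 (vT : vectType C) (I : eqType) (f : I -> vT) (r : seq I)
    (a : I -> C) :
  free [seq f i | i <- r] -> \sum_(i <- r) a i *: f i = 0 ->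
  forall i, i \in r -> a i = 0.
Proof.
move=> fr fa0 i /(tnthP (in_tuple r))[j ->].
have /freeP := fr : free (map_tuple f (in_tuple r)).
move=> /(_ (fun j => a (tnth (in_tuple r) j))); apply.
rewrite -[RHS]fa0 [RHS]big_tnth; apply: eq_bigr => l _.
by rewrite -tnth_nth tnth_map.
Qed.

Lemma free_general_position d N (u : 'I_N -> 'cV[C]_d) : (d <= N)%N ->
  (forall S : {set 'I_N}, #|S| = d -> free [seq u k | k in S]) ->
  general_position u.
Proof.
move=> dN freeu m h h_inj md a ah0 i.
pose s := codom h; pose r := [seq k <- enum 'I_N | k \notin s].
(* The image of [h] is completed to exactly [d] distinct indices by fresh ones, which exist since
   [d <= N]; freeness then descends to the prefix [s]. *)
pose q := s ++ take (d - m) r.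
have s_uniq : uniq s by apply/injectiveP.
have s_size : size s = m by rewrite size_codom card_ord.
have r_uniq : uniq r by rewrite filter_uniq // enum_uniq.
have r_size : size r = (N - m)%N.
  rewrite -(card_uniqP r_uniq) -[N in RHS]card_ord -(cardC (mem s)).
  rewrite (card_uniqP s_uniq) s_size addKn; apply: eq_card => k.
  by rewrite mem_filter mem_enum andbT !inE.
have q_uniq : uniq q.
  rewrite cat_uniq s_uniq take_uniq // andbT; apply/hasPn => k /mem_take.
  by rewrite mem_filter => /andP[].
have q_size : size q = d by rewrite size_cat s_size size_takel ?r_size; lia.
have /freeu free_q : #|[set k in q]| = d by rewrite cardsE (card_uniqP q_uniq).
have qE : perm_eq (enum [set k in q]) q.
  by apply: uniq_perm => // [|k]; rewrite ?enum_uniq // mem_enum inE.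
move: free_q; rewrite (perm_free (perm_map u qE)) map_cat => /catl_free.
rewrite -map_comp => /free_map_sum0; apply; last by rewrite mem_enum.
by rewrite big_enum.
Qed.

Lemma free_pair_indep (vT wT : vectType C) N (f : 'I_N -> vT) (g : 'I_N -> wT)
    (a : 'I_N -> C) :
  free [seq (f k, g k) | k : 'I_N] ->
  \sum_k a k *: f k = 0 -> \sum_k a k *: g k = 0 -> forall k, a k = 0.
Proof.
move=> fr fa0 ga0 k; apply: (free_map_sum0 fr); last by rewrite mem_enum.
rewrite big_enum /=; apply/eqP; rewrite -pair_eqE /=; apply/andP; split.
  by rewrite (raddf_sum fst) -[X in _ == X]fa0.
by rewrite (raddf_sum snd) -[X in _ == X]ga0.
Qed.

Lemma orthonormal_coef d N (u : 'I_N -> 'cV[C]_d) (I : finType) (h : I -> 'I_N)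
    (a : I -> C) : (forall i j, inner (u i) (u j) = (i == j)%:R) ->
  injective h -> \sum_i a i *: u (h i) = 0 -> forall i, a i = 0.
Proof.
move=> uu h_inj au0 i; have := congr1 (inner (u (h i))) au0.
rewrite inner_sumr (bigD1 i) //= big1 => [|j ji].
  by rewrite addr0 innerZr uu eqxx mulr1 /inner mulmx0 mxE.
by rewrite innerZr uu inj_eq // eq_sym (negPf ji) mulr0.
Qed.

End Free.

(** * Twisted dephasing channels as the case of two orthonormal bases *)

Section TwistedDephasing.
Variables (C : numClosedFieldType) (d : nat).

Lemma unitary_col_inner (U : 'M[C]_d) : U \is unitarymx ->
  forall i j, inner (col i U) (col j U) = (i == j)%:R.
Proof.
move=> /unitarymxP/mulmx1C UU i j; have /matrixP/(_ i j) := UU.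
by rewrite innerE !mxE => <-; apply: eq_bigr => k _; rewrite !mxE.
Qed.

Lemma unitary_col_sum (U : 'M[C]_d) : U \is unitarymx ->
  \sum_k 1 *: ketbra (col k U) (col k U) = 1%:M.
Proof.
move=> /unitarymxP <-; apply/matrixP => i j; rewrite summxE mxE.
by apply: eq_bigr => k _; rewrite scale1r ketbra_entry !mxE.
Qed.

(** The unit weights stay explicit to match the form of [tau] with all [p k] equal to 1. *)
Lemma twisted_dephasingE (U V : 'M[C]_d) :
  twisted_dephasing U V = \sum_k 1 *: Ad (ketbra (col k U) (col k V)).
Proof.
apply/funext => X.
rewrite sum_Ad_ketbraE /twisted_dephasing /= /dephasing /Ad trmxCK.
rewrite mulmx_sumr mulmx_suml; apply: eq_bigr => k _.
rewrite mul1r -scalemxAr -scalemxAl !colE /inner /ketbra !adjmxM.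
by rewrite !mulmxA.
Qed.

Lemma twisted_dephasing_extreme (U V : 'M[C]_d) : (0 < d)%N ->
  U \is unitarymx -> V \is unitarymx ->
  extreme_point (@UEBTP C d) (twisted_dephasing U V).
Proof.
move=> d0 Uu Vu; rewrite twisted_dephasingE.
have colU := unitary_col_inner Uu; have colV := unitary_col_inner Vu.
apply: tau_extreme => //; rewrite ?leq_maxl ?unitary_col_sum //.
- by move=> k; rewrite colU eqxx.
- by move=> k; rewrite colV eqxx.
- by move=> m h h_inj _ a; exact: (orthonormal_coef colU).
- by move=> m h h_inj _ a; exact: (orthonormal_coef colV).
move=> a aU _ k.
(* The projectors on the columns of [U] are already independent: applying a relation between them to
   column [k] isolates [a k]. *)
have := orthonormal_coef (h := id) (a := fun l => a l * (l == k)%:R) colU.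
move=> /(_ (@inj_id _) _ k); rewrite eqxx mulr1; apply.
rewrite -[RHS](mul0mx _ (col k U)) -[in RHS]aU mulmx_suml.
by apply: eq_bigr => l _; rewrite -scalemxAl ketbraE colU scalerA.
Qed.

End TwistedDephasing.

Local Open Scope complex_scope.

Theorem corollary3p8 (R : realType) (d : nat) (hd : (0 < d)%N) :
  (forall (N : nat) (u v : 'I_N -> 'cV[R[i]]_d) (p : 'I_N -> R),
    (d <= N)%N -> (N <= 2 * d - 2)%N ->
    (forall k, inner (u k) (u k) = 1) ->
    (forall k, inner (v k) (v k) = 1) ->
    (forall k, 0 < p k) ->
    \sum_k (p k)%:C *: ketbra (u k) (u k) = 1%:M ->
    \sum_k (p k)%:C *: ketbra (v k) (v k) = 1%:M ->
    (forall S : {set 'I_N}, #|S| = d -> free [seq u k | k in S]) ->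
    (forall S : {set 'I_N}, #|S| = d -> free [seq v k | k in S]) ->
    free [seq (ketbra (u k) (u k), ketbra (v k) (v k)) | k : 'I_N] ->
    let tau : 'M[R[i]]_d -> 'M[R[i]]_d :=
      \sum_k (p k)%:C *: Ad (ketbra (u k) (v k)) in
    [/\ extreme_point (@UEBTP R[i] d) tau,
        choi_rank_is tau N
      & eb_rank_is tau N])
  /\
  (forall U V : 'M[R[i]]_d, U \is unitarymx -> V \is unitarymx ->
    extreme_point (@UEBTP R[i] d) (twisted_dephasing U V)).
Proof.
split=> [N u v p dN Nd u1 v1 p0 uI vI freeu freev freeuv tau|U V].
  have gu := free_general_position dN freeu.
  have gv := free_general_position dN freev.
  have {}Nd : (N <= maxn d (2 * d - 2))%N by rewrite leq_max Nd orbT.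
  have pC k : 0 < (p k)%:C by rewrite ltcR.
  split.
  - by apply: tau_extreme => // a; apply: free_pair_indep.
  - exact: tau_choi_rank.
  - exact: tau_eb_rank.
exact: twisted_dephasing_extreme.
Qed.
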